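(* Suppose that there is a phase lag $\phi\in\,]0,1[$ with $e_-(t)=e_+(t+\phi)$ for all $t\ge0$. Suppose that $e_-$ is twice continuously differentiable and has its global maximum at $t_1$, and its global minimum at $t_2$, where $t_1<t_2$. Suppose further that there is a unique point $t_1<s<t_2$ such that $e_-|_{]t_1,s[}$ is strictly concave and $e_-|_{]s,t_2[}$ is strictly convex. Then $\mu_R=e_-(s)$ is the stochastic resonance point.
   Context: Setting. $b:[0,\infty)\times\mathbb R^d\to\mathbb R^d$ is one-periodic in its first (time) variable and satisfies: for all $R>0$, $x\in\mathbb R^d$ there are constants $K_R(x),\kappa_R(x)$ with $\|b(t,y_1)-b(t,y_2)\|\le K_R(x)\|y_1-y_2\|$ and $\|b(t,y)-b(s,y)\|\le\kappa_R(x)|t-s|$ for all $y,y_1,y_2$ in the Euclidean ball $B_R(x)$, $s,t\ge0$; and there are constants $\bar\eta,R_0>0$ with $\langle x,b(t,x)\rangle<-\bar\eta\|x\|$ for all $t\ge0$, $\|x\|\ge R_0$. For every $s\ge0$ the frozen equation $\dot\varphi_s(t)=b(s,\varphi_s(t))$ in $\mathbb R^d$ has two stable equilibria $x_-,x_+$ which do not depend on $s$; their domains of attraction $A_\pm$ do not depend on $s$, and $\overline{A_-\cup A_+}=\mathbb R^d$, $\partial A_-=\partial A_+=:\chi$. Energies. $C_{0t}=C([0,t],\mathbb R^d)$; $I^s_{0t}(\varphi)=\frac12\int_0^t\|\dot\varphi_u-b(s,\varphi_u)\|^2du$ if $\varphi$ is absolutely continuous, $+\infty$ otherwise; $V^s(x,y)=\inf_{t>0}\inf\{I^s_{0t}(\varphi):\varphi\in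 C_{0t},\varphi_0=x,\varphi_t=y\}$; $e_\pm(s)=\inf_{y\in\chi}V^s(x_\pm,y)<\infty$, continuous one-periodic functions. Each of $e_-,e_+$ is assumed strictly monotone between its (discrete) extremes, with every local extremum global. Set $a^\pm_\mu=\inf\{t\ge0:e_\pm(t)\le\mu\}$ and define the resonance interval $$I_R=\Big]\max_{i=\pm}\inf_{t\ge0}e_i(t),\ \inf_{t\ge0}\max_{i=\pm}e_i(t)\Big[.$$ It is assumed that $e_i(0)>\inf_{t\ge0}\max_{j=\pm}e_j(t)$ for $i=\pm$ (so that $a^i_\mu>0$ for $\mu\in I_R$). Stochastic resonance point. Suppose that (for small $h>0$) the function $I_R\ni\mu\mapsto\max_{i=\pm}\{\mu-e_i(a^i_\mu-h)\}$ possesses a global minimum $\mu_R(h)$ (i.e. a global minimizer), and that $\mu_R=\lim_{h\to0}\mu_R(h)$ exists in $I_R$. Then $\mu_R$ is called the stochastic resonance point of the diffusions $dX^\varepsilon_t=b(t/T^\varepsilon,X^\varepsilon_t)dt+\sqrt\varepsilon\,dW_t$, $T^\varepsilon=e^{\mu/\varepsilon}$, with time periodic drift $b$.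
   Formalization: Proved: any stochastic resonance point equals e_-(s), and e_-(s) is one if it lies in I_R (for some phase lags it does not, and then none exists); the global maximum and minimum of e_- are taken to be unique up to integer time shifts. *)

(* Defs.v *)
From HB Require Import structures.
From mathcomp Require Import all_boot all_order all_algebra.
From mathcomp Require Import all_classical all_reals all_analysis.

Set Implicit Arguments.
Unset Strict Implicit.
Unset Printing Implicit Defensive.

Import Order.TTheory GRing.Theory Num.Theory.
Import numFieldNormedType.Exports.

Local Open Scope classical_set_scope.
Local Open Scope ring_scope.

(* Quantities depending on time are total functions on R of which only the
   values at nonnegative times are meaningful or constrained. *)

Section Drift.
Context {R : realType} {d : nat}.
Implicit Types (b : R -> 'rV[R]_d -> 'rV[R]_d) (s t : R) (x y : 'rV[R]_d)
  (phi : R -> 'rV[R]_d) (A : set 'rV[R]_d).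

Definition dot x y : R := (x *m y^T) 0 0.

(* The library's norm on row vectors is the sup norm; it induces the same
   topology as the Euclidean norm below. *)
Definition enorm x : R := Num.sqrt (dot x x).

Definition eball x (r : R) : set 'rV[R]_d := [set y | enorm (y - x) < r].

Definition one_periodic_drift b : Prop :=
  forall t x, 0 <= t -> b (t + 1) x = b t x.

Definition locally_lipschitz b : Prop :=
  forall (r : R) x, 0 < r -> exists K kappa : R,
    (forall t y1 y2, 0 <= t -> eball x r y1 -> eball x r y2 ->
      enorm (b t y1 - b t y2) <= K * enorm (y1 - y2)) /\
    (forall s t y, 0 <= s -> 0 <= t -> eball x r y ->
      enorm (b t y - b s y) <= kappa * `|t - s|).

Definition dissipative b : Prop :=
  exists eta R0 : R, [/\ 0 < eta, 0 < R0 &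
    forall t x, 0 <= t -> R0 <= enorm x ->
      dot x (b t x) < - eta * enorm x].

Definition frozen_solution b s phi : Prop :=
  {within `[0, +oo[, continuous phi} /\
  forall t, 0 < t -> is_derive t (1 : R) phi (b s (phi t)).

(* Equilibrium which is stable in the sense of Lyapunov. *)
Definition stable_equilibrium b s x : Prop :=
  b s x = 0 /\
  forall eps : R, 0 < eps -> exists2 delta : R, 0 < delta &
    forall phi, frozen_solution b s phi -> enorm (phi 0 - x) < delta ->
      forall t, 0 <= t -> enorm (phi t - x) < eps.

Definition domain_of_attraction b s x : set 'rV[R]_d :=
  [set y | exists phi, [/\ frozen_solution b s phi, phi 0 = y &
                           phi t @[t --> +oo] --> x]].

Definition boundary A : set 'rV[R]_d := closure A `\` A°.

Definition absolutely_continuous t phi : Prop :=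
  forall eps : R, 0 < eps -> exists2 delta : R, 0 < delta &
    forall (n : nat) (l r : 'I_n -> R),
      (forall k, [/\ 0 <= l k, l k < r k & r k <= t]) ->
      (forall j k, j != k -> r j <= l k \/ r k <= l j) ->
      \sum_k (r k - l k) < delta ->
      \sum_k enorm (phi (r k) - phi (l k)) < eps.

(* An absolutely continuous path is differentiable almost everywhere, so the
   unspecified value of [derive1 phi] at other points does not affect the
   integral. *)
Definition action b s t phi : \bar R :=
  if `[< absolutely_continuous t phi >] then
    ((2%:R^-1)%:E *
     \int[lebesgue_measure]_(u in `[0%R, t])
       (enorm (derive1 phi u - b s (phi u)) ^+ 2)%:E)%E
  else +oo%E.

Definition quasipotential b s x y : \bar R :=
  ereal_inf [set v | exists t phi,
    [/\ 0 < t, {within `[0, t], continuous phi}, phi 0 = x, phi t = y &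
        v = action b s t phi]].

Definition exit_energy b (chi : set 'rV[R]_d) x s : \bar R :=
  ereal_inf [set quasipotential b s x y | y in chi].

Definition energy b (chi : set 'rV[R]_d) x s : R := fine (exit_energy b chi x s).

End Drift.

Section Energies.
Context {R : realType}.
Implicit Types (e em ep f : R -> R) (h mu t : R).

(* For the one-periodic functions considered here an extremum at time 0
   recurs at time 1, so only interior extrema are recorded: this excludes the
   endpoint 0 of the half-line, which need not be an extremum of the periodic
   function. *)
Definition local_max f t : Prop := 0 < t /\ \forall u \near t, f u <= f t.
Definition local_min f t : Prop := 0 < t /\ \forall u \near t, f t <= f u.
Definition local_extremum f t : Prop := local_max f t \/ local_min f t.

Definition strictly_monotone_on f (a c : R) : Prop :=
  {in `[a, c] &, {homo f : u v / u < v}} \/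
  {in `[a, c] &, {homo f : u v / u < v >-> v < u}}.

Definition monotone_between_extrema f : Prop :=
  [/\ forall T : R, finite_set [set t | local_extremum f t /\ t <= T],
      forall a c : R, local_extremum f a -> local_extremum f c -> a < c ->
        (forall t, a < t < c -> ~ local_extremum f t) ->
        strictly_monotone_on f a c,
      forall t, local_max f t -> forall u, 0 <= u -> f u <= f t &
      forall t, local_min f t -> forall u, 0 <= u -> f t <= f u].

(* [t] is the global maximum (resp. minimum) point of a one-periodic function,
   hence unique up to integer translations. *)
Definition global_max_at f t : Prop :=
  [/\ 0 <= t, forall u, 0 <= u -> f u <= f t &
      forall u, 0 <= u -> f u = f t -> exists k : int, u = t + k%:~R].
Definition global_min_at f t : Prop :=
  [/\ 0 <= t, forall u, 0 <= u -> f t <= f u &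
      forall u, 0 <= u -> f u = f t -> exists k : int, u = t + k%:~R].

(* Regularity at time 0 follows from that at time 1 by periodicity. *)
Definition twice_continuously_differentiable f : Prop :=
  forall t, 0 < t ->
    [/\ derivable f t 1, derivable (derive1 f) t 1 & {for t, continuous (derive1n 2 f)}].

Definition strictly_convex_on f (a c : R) : Prop :=
  forall u v l : R, a < u < c -> a < v < c -> u != v -> 0 < l < 1 ->
    f (l * u + (1 - l) * v) < l * f u + (1 - l) * f v.
Definition strictly_concave_on f (a c : R) : Prop :=
  strictly_convex_on (fun t => - f t) a c.

Definition inflection_between f (t1 t2 s : R) : Prop :=
  [/\ t1 < s < t2, strictly_concave_on f t1 s & strictly_convex_on f s t2].

Definition hitting_time e mu : R := inf [set t | 0 <= t /\ e t <= mu].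

Definition inf_max em ep : R :=
  inf [set Num.max (em t) (ep t) | t in `[0, +oo[].

Definition resonance_interval em ep : interval R :=
  `](Num.max (inf [set em t | t in `[0, +oo[]) (inf [set ep t | t in `[0, +oo[])),
    (inf_max em ep)[.

Definition resonance_objective em ep h mu : R :=
  Num.max (mu - em (hitting_time em mu - h)) (mu - ep (hitting_time ep mu - h)).

Definition stochastic_resonance_point em ep (muR : R) : Prop :=
  muR \in resonance_interval em ep /\
  exists mu_ : R -> R,
    (\forall h \near 0^'+,
       mu_ h \in resonance_interval em ep /\
       forall mu, mu \in resonance_interval em ep ->
         resonance_objective em ep h (mu_ h) <= resonance_objective em ep h mu) /\
    mu_ h @[h --> 0^'+] --> muR.

End Energies.

(* Main.v *)
Require Import Defs.
From HB Require Import structures.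
From mathcomp Require Import all_boot all_order all_algebra.
From mathcomp Require Import all_classical all_reals all_analysis.
From mathcomp Require Import ring lra.
Import Order.TTheory GRing.Theory Num.Theory.
Import numFieldNormedType.Exports.
Local Open Scope classical_set_scope.
Local Open Scope ring_scope.

(* On its decreasing branch [t1, t2] each level mu of e_- is attained at exactly
   one point x.  As e_+ is a translate of e_-, both hitting times of mu are
   translates of x, so the objective equals e_-(x) - e_-(x - h).  Such increments
   decrease in x while e_- is concave and increase once it is convex, so for small
   h the minimizing x lies in [s, s + h] and tends to the inflection point s. *)

(** * Increments of strictly convex and strictly concave functions *)

(** Both [x] and [y - h] are convex combinations of [x - h] and [y], with exchanged weights [l] and
    [1 - l]; the two convexity inequalities are added. *)
Lemma strictly_convex_increment (R : realType) (f : R -> R) (a c x y h : R) :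
  strictly_convex_on f a c -> 0 < h -> a < x - h -> x < y -> y < c ->
  f x - f (x - h) < f y - f (y - h).
Proof.
move=> cvx h0 ax xy yc; set l := (y - x) / (y - x + h).
have d0 : 0 < y - x + h by lra.
have l01 : 0 < l < 1.
  by rewrite divr_gt0//= ?ltr_pdivrMr//; lra.
have xE : x = l * (x - h) + (1 - l) * y by rewrite /l; field; lra.
have yE : y - h = (1 - l) * (x - h) + (1 - (1 - l)) * y.
  by rewrite /l; field; lra.
have xhy : x - h != y by lra.
have Hx := cvx (x - h) y l ltac:(lra) ltac:(lra) xhy l01.
have Hy := cvx (x - h) y (1 - l) ltac:(lra) ltac:(lra) xhy ltac:(lra).
rewrite -xE in Hx; rewrite -yE in Hy; lra.
Qed.

Lemma strictly_concave_increment (R : realType) (f : R -> R) (a c x y h : R) :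
  strictly_concave_on f a c -> 0 < h -> a < x - h -> x < y -> y < c ->
  f y - f (y - h) < f x - f (x - h).
Proof.
move=> ccv h0 ax xy yc.
have := @strictly_convex_increment _ (fun t => - f t) _ _ _ _ _ ccv h0 ax xy yc.
lra.
Qed.

(** At an interior maximum the increment into [p] is nonnegative and the one out of [p] nonpositive,
    whereas convexity makes increments grow. *)
Lemma strictly_convex_no_max (R : realType) (f : R -> R) (a c p : R) :
  strictly_convex_on f a c -> a < p < c ->
  ~ (forall u, a < u < c -> f u <= f p).
Proof.
move=> cvx /andP[ap pc] pmax.
pose h := Num.min (p - a) (c - p) / 2%:R.
have /andP[h1 h2] : (h < p - a) && (h < c - p).
  by rewrite /h; case: (leP (p - a) (c - p)) => ?; apply/andP; split; lra.
have h0 : 0 < h by rewrite divr_gt0// lt_min; apply/andP; split; lra.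
have := @strictly_convex_increment _ f a c p (p + h) h cvx h0
  ltac:(lra) ltac:(lra) ltac:(lra).
rewrite addrK.
have := pmax (p - h) ltac:(lra); have := pmax (p + h) ltac:(lra); lra.
Qed.

Lemma strictly_concave_no_min (R : realType) (f : R -> R) (a c p : R) :
  strictly_concave_on f a c -> a < p < c ->
  ~ (forall u, a < u < c -> f p <= f u).
Proof.
move=> ccv apc pmin; apply: (strictly_convex_no_max _ _ _ _ _ ccv apc) => u auc.
by rewrite lerN2 pmin.
Qed.

Lemma inf_image_min (R : realType) (h : R -> R) (a : R) : 0 <= a ->
  (forall t, 0 <= t -> h a <= h t) -> inf [set h t | t in `[0, +oo[] = h a.
Proof.
move=> a0 amin.
have ha : [set h t | t in `[0, +oo[] (h a) by exists a; rewrite //= in_itv/= a0.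
have lb : lbound [set h t | t in `[0, +oo[] (h a).
  by move=> y [t]; rewrite /= in_itv/= andbT => t0 <-; exact: amin.
apply: le_anti; rewrite lb_le_inf ?andbT//; last by exists (h a).
by apply: ge_inf => //; exists (h a).
Qed.

Lemma energy_periodic (R : realType) (d : nat) (b : R -> 'rV[R]_d -> 'rV[R]_d)
    (chi : set 'rV[R]_d) (x : 'rV[R]_d) :
  one_periodic_drift b ->
  forall t, 0 <= t -> energy b chi x (t + 1) = energy b chi x t.
Proof.
move=> bper t t0.
have bE : b (t + 1) = b t by apply/funext => y; exact: bper.
by rewrite /energy /exit_energy /quasipotential /action bE.
Qed.

(** * Shape of a one-periodic well over one period *)

Section PeriodicWell.
Context {R : realType} (f : R -> R) (t1 t2 s : R).
Hypothesis f_periodic : forall t, 0 <= t -> f (t + 1) = f t.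
Hypothesis f_monotone : monotone_between_extrema f.
Hypothesis f_max : global_max_at f t1.
Hypothesis f_min : global_min_at f t2.
Hypothesis t1_lt_t2 : t1 < t2.
Hypothesis s_inflection : inflection_between f t1 t2 s.

Lemma periodic_int (k : int) (u : R) :
  0 <= u -> 0 <= u + k%:~R -> f (u + k%:~R) = f u.
Proof.
have pnat (n : nat) v : 0 <= v -> f (v + n%:R) = f v.
  elim: n v => [|n IH] v v0; first by rewrite addr0.
  by rewrite -natr1 addrA f_periodic ?IH// addr_ge0.
case: k => n u0 un0; first exact: pnat.
(* For negative [k] the natural shift starts from [u + k], which must itself be nonnegative. *)
rewrite NegzE mulrNz in un0 *.
by rewrite -[in RHS](subrK n.+1%:R u) pnat.
Qed.

Let t1_ge0 : 0 <= t1. Proof. by case: f_max. Qed.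
Let f_le_max u : 0 <= u -> f u <= f t1. Proof. by case: f_max => _ + _; exact. Qed.
Let f_ge_min u : 0 <= u -> f t2 <= f u. Proof. by case: f_min => _ + _; exact. Qed.
Let max_uniq u : 0 <= u -> f u = f t1 -> exists k : int, u = t1 + k%:~R.
Proof. by case: f_max => _ _; exact. Qed.
Let min_uniq u : 0 <= u -> f u = f t2 -> exists k : int, u = t2 + k%:~R.
Proof. by case: f_min => _ _; exact. Qed.

(* Otherwise both a minimum and, after it, a maximum would lie strictly
   between [t1] and [t2], against the concave-convex shape there. *)
Lemma min_before_next_max : t2 < t1 + 1.
Proof.
have t10 := t1_ge0.
have [/andP[t1s st2] ccv cvx] := s_inflection.
rewrite ltNge; apply/negP => t12.
(* [t2 - k] is the minimum point brought back into [[t1, t1 + 1[]; concavity keeps it out of []t1,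
   s[]. *)
pose k := Num.floor (t2 - t1).
have /andP[k_le k_lt] := floor_itv (t2 - t1).
rewrite -/k in k_le; rewrite -/k intrD in k_lt.
have t0 : 0 <= t2 + (- k)%:~R by rewrite intrN; lra.
have fE : f (t2 + (- k)%:~R) = f t2 by apply: periodic_int => //; lra.
have f1 : f (t1 + 1) = f t1 by exact: f_periodic.
have smin : s <= t2 + (- k)%:~R \/ t2 + (- k)%:~R = t1.
  have [?|ts] := leP s (t2 + (- k)%:~R); first by left.
  have [|lt1] := leP (t2 + (- k)%:~R) t1; first by rewrite intrN; right; lra.
  exfalso; apply: (strictly_concave_no_min _ _ _ _ (t2 + (- k)%:~R) ccv).
    by rewrite lt1 ts.
  by move=> u ?; rewrite fE f_ge_min//; lra.
(* Otherwise [f] would be constant, against strict concavity. *)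
have nconst : f t2 != f t1.
  apply/eqP => ft; apply: (strictly_concave_no_min _ _ _ _ ((t1 + s) / 2%:R) ccv).
    by lra.
  move=> u ?; have := f_le_max ((t1 + s) / 2%:R) ltac:(lra).
  by have := f_ge_min u ltac:(lra); lra.
case: smin => [sle|E]; last by rewrite -fE E eqxx in nconst.
(* The next maximum [t1 + 1] comes after [t2 - k], hence lies inside the convex part. *)
apply: (strictly_convex_no_max _ _ _ _ (t1 + 1) cvx).
  apply/andP; split.
    by move: sle; rewrite intrN; lra.
  by rewrite lt_neqAle t12 andbT; apply: contra nconst => /eqP <-; rewrite f1.
by move=> u ?; rewrite f1 f_le_max//; lra.
Qed.

Let t2t1 := min_before_next_max.

Let int_lt1 (k : int) : 0 < (k%:~R : R) -> (k%:~R : R) < 1 -> False.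
Proof. by rewrite ltr0z ltrz1; case: k => -[]. Qed.

Let int_apart (t : R) (k : int) : t < t + k%:~R -> t + k%:~R < t + 1 -> False.
Proof. by move=> ? ?; apply: (int_lt1 k); lra. Qed.

(** * Extrema and the monotone branches between them *)

Let local_extremum_global t : local_extremum f t ->
  (exists k : int, t = t1 + k%:~R) \/ (exists k : int, t = t2 + k%:~R).
Proof.
have [_ _ lmax lmin] := f_monotone.
have t20 := ltW (le_lt_trans t1_ge0 t1_lt_t2).
case=> -[/[dup] /ltW t0' t0 ext].
  left; apply: max_uniq => //; apply: le_anti.
  by rewrite f_le_max// lmax.
right; apply: min_uniq => //; apply: le_anti.
by rewrite f_ge_min// lmin.
Qed.

(** The maximum is taken one period later because [t1] may be 0, and local extrema are recorded at
    positive times only. *)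
Let local_max_t1 : local_max f (t1 + 1).
Proof.
have t10 := t1_ge0; have t1p : 0 < t1 + 1 by lra.
split=> //; near=> u; rewrite f_periodic// f_le_max// ltW//.
by near: u; exact: lt_nbhsr.
Unshelve. all: by end_near. Qed.

Let local_min_gt0 t : 0 < t -> f t = f t2 -> local_min f t.
Proof.
move=> t0 ft; split=> //; near=> u; rewrite ft f_ge_min// ltW//.
by near: u; exact: lt_nbhsr.
Unshelve. all: by end_near. Qed.

(** By [min_before_next_max] no translate of [t1] or [t2] lies strictly between [t1 + 1] and
    [t2 + 1], so [f] is strictly monotone there, and it cannot increase from its maximum. Other
    branches are integer translates, possibly cut off at time 0. *)
Lemma decreasing_to_min (n : int) (u v : R) :
  0 <= u -> t1 + n%:~R <= u -> u < v -> v <= t2 + n%:~R -> f v < f u.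
Proof.
have [[t10 t12] t21] := (t1_ge0, t1_lt_t2, t2t1).
move=> u0 nu uv vn.
have [_ mono _ _] := f_monotone.
have f1 : f (t1 + 1) = f t1 by exact: f_periodic.
have f2 : f (t2 + 1) = f t2 by apply: f_periodic; lra.
have nonext t : t1 + 1 < t < t2 + 1 -> ~ local_extremum f t.
  move=> tt /local_extremum_global[] [k tE].
    apply: (int_apart (t1 + 1) (k - 1)); rewrite intrD; lra.
  by apply: (int_apart (t2 - 0) k); lra.
have := mono (t1 + 1) (t2 + 1) (or_introl local_max_t1)
  (or_intror (local_min_gt0 (t2 + 1) ltac:(lra) f2)) ltac:(lra) nonext.
have red w : 0 <= w -> t1 + n%:~R <= w -> w <= t2 + n%:~R ->
    f (w + (1 - n)%:~R) = f w.
  move=> w0 ? ?; apply: periodic_int => //; rewrite intrB; lra.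
case=> mon; last first.
  rewrite -(red u)//; last lra.
  rewrite -(red v)//; [|lra..].
  by apply: mon; rewrite ?in_itv/= ?intrB; lra.
have := mon (t1 + 1) (t2 + 1); rewrite !in_itv/= f1 f2.
have := f_le_max t2 ltac:(lra).
by move=> ? /(_ ltac:(lra) ltac:(lra) ltac:(lra)); lra.
Qed.

Lemma increasing_to_max (n : int) (u v : R) :
  0 <= u -> t2 + n%:~R <= u -> u < v -> v <= t1 + n%:~R + 1 -> f u < f v.
Proof.
have [[t10 t12] t21] := (t1_ge0, t1_lt_t2, t2t1).
move=> u0 nu uv vn.
have [_ mono _ _] := f_monotone.
have f1 : f (t1 + 1) = f t1 by exact: f_periodic.
have nonext t : t2 < t < t1 + 1 -> ~ local_extremum f t.
  move=> tt /local_extremum_global[] [k tE].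
    by apply: (int_apart t1 k); lra.
  by apply: (int_apart t2 k); lra.
have := mono t2 (t1 + 1) (or_intror (local_min_gt0 t2 ltac:(lra) erefl))
  (or_introl local_max_t1) ltac:(lra) nonext.
have red w : 0 <= w -> t2 + n%:~R <= w -> w <= t1 + n%:~R + 1 ->
    f (w + (- n)%:~R) = f w.
  move=> w0 ? ?; apply: periodic_int => //; rewrite intrN; lra.
case=> mon.
  rewrite -(red u)//; last lra.
  rewrite -(red v)//; [|lra..].
  by apply: mon; rewrite ?in_itv/= ?intrN; lra.
have := mon t2 (t1 + 1); rewrite !in_itv/= f1.
have := f_le_max t2 ltac:(lra).
by move=> ? /(_ ltac:(lra) ltac:(lra) ltac:(lra)); lra.
Qed.

(* [x] parametrizes the levels by the decreasing branch of the well, so the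
   hitting times of all shifts of [f] are translates of [x]. *)
Lemma hitting_time_shift (p M : R) : 0 <= p -> M < f p ->
  exists n : int, forall x, t1 < x < t2 -> f x <= M ->
    p < x + n%:~R /\ forall g : R -> R, (forall t, 0 <= t -> g t = f (t + p)) ->
      hitting_time g (f x) = x + n%:~R - p.
Proof.
(* The integer [n] below makes [t2 + n] the first translate of the minimum after [p], so the level
   is first reached on the branch ending there. *)
have [[t10 t12] t21] := (t1_ge0, t1_lt_t2, t2t1).
move=> p0 Mp; have /andP[n_le n_lt] := floor_itv (p - t2).
set n := Num.floor (p - t2) + 1 in n_lt.
have nE : (Num.floor (p - t2))%:~R = n%:~R - 1 :> R by rewrite /n intrD addrK.
rewrite nE in n_le.
exists n => x x12 xM.
(* Either [p] is already on that decreasing branch, or it is on the rise before it, where [f] stays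
   above [f p] and so above [M]. *)
have peak : t1 + n%:~R <= p \/
    (p < t1 + n%:~R /\ forall t, p <= t -> t <= t1 + n%:~R -> f p <= f t).
  have [?|pt1] := leP (t1 + n%:~R) p; [by left | right; split => // t pt tn].
  have [->//|npt] := eqVneq p t.
  by apply/ltW/(increasing_to_max (n - 1)); rewrite ?intrB//; lra.
have fxn : 0 <= x + n%:~R -> f (x + n%:~R) = f x.
  by move=> ?; apply: periodic_int => //; lra.
have pxn : p < x + n%:~R.
  case: peak => [pk|[pk _]]; last by lra.
  rewrite ltNge; apply/negP => xp.
  have pn : 0 <= p + (- n)%:~R by rewrite intrN; lra.
  suff : f (p + (- n)%:~R) <= f x by rewrite periodic_int//; lra.
  have [<-//|xnp] := eqVneq x (p + (- n)%:~R).
  apply/ltW/(decreasing_to_min 0); rewrite ?intrN in xnp *; lra.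
split=> // g gE.
have above t : p <= t -> t < x + n%:~R -> f x < f t.
  move=> pt tx; have [tn|tn] := leP t (t1 + n%:~R).
    case: peak => [pk|[_ pk]].
      suff : f x < f t by [].
      rewrite -fxn; last lra.
      by apply: (decreasing_to_min n); lra.
    by have := pk t pt tn; lra.
  rewrite -fxn; last lra.
  by apply: (decreasing_to_min n); lra.
rewrite /hitting_time; set A := (X in inf X).
have Ax : A (x + n%:~R - p).
  split; first by lra.
  by rewrite gE ?subrK ?fxn//; lra.
have lbA : lbound A (x + n%:~R - p).
  move=> t [t0]; rewrite gE// => gt; rewrite leNgt; apply/negP => tx.
  by have := above (t + p); lra.
apply/eqP; rewrite eq_le; apply/andP; split.
  by apply: ge_inf => //; exists (x + n%:~R - p).
by apply: lb_le_inf => //; exists (x + n%:~R - p).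
Qed.

Lemma decreasing_branch (u v : R) : t1 <= u -> u < v -> v <= t2 -> f v < f u.
Proof.
have t10 := t1_ge0.
by move=> *; apply: (decreasing_to_min 0); rewrite ?addr0//; lra.
Qed.

Hypothesis f_continuous : forall t, 0 < t -> {for t, continuous f}.

(** The intermediate value theorem is applied one period later: [t1] may be 0, and continuity is
    given at positive times. *)
Lemma decreasing_branch_onto (mu : R) : f t2 < mu < f t1 ->
  exists2 x, t1 < x < t2 & f x = mu.
Proof.
have [t10 t12] := (t1_ge0, t1_lt_t2).
move=> /andP[mu2 mu1].
have f1 : f (t1 + 1) = f t1 by exact: f_periodic.
have f2 : f (t2 + 1) = f t2 by apply: f_periodic; lra.
have [|||x] := @IVT R f (t1 + 1) (t2 + 1) mu; first by lra.
- apply: continuous_in_subspaceT => x; rewrite inE/= in_itv/= => ?.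
  by apply: f_continuous; lra.
- by rewrite f1 f2 minElt maxElt; case: ltP => ?; lra.
rewrite in_itv/= => xI fx.
have fx1 : f (x - 1) = mu by rewrite -fx -[in RHS](subrK 1 x) f_periodic//; lra.
exists (x - 1) => //; rewrite !lt_neqAle; apply/andP; split; apply/andP; split; try lra.
  by apply/eqP => E; rewrite E fx1 ltxx in mu1.
by apply/eqP => E; rewrite -E fx1 ltxx in mu2.
Qed.

(** * The lagged well and the resonance objective *)

Variables (g : R -> R) (phase : R).
Hypothesis g_periodic : forall t, 0 <= t -> g (t + 1) = g t.
Hypothesis phase01 : 0 < phase < 1.
Hypothesis phase_lag : forall t, 0 <= t -> f t = g (t + phase).
Hypothesis f_0 : inf_max f g < f 0.
Hypothesis g_0 : inf_max f g < g 0.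

(** Periodicity turns the delay into an advance, so [f] is evaluated at nonnegative times only. *)
Lemma lagged_shift t : 0 <= t -> g t = f (t + (1 - phase)).
Proof.
have ph := phase01 => t0.
rewrite phase_lag; last lra.
by rewrite -addrA subrK g_periodic.
Qed.

(** Being translates of each other, the two energies have the same minimum [f t2]. *)
Lemma mem_resonance_interval mu :
  (mu \in resonance_interval f g) = (f t2 < mu < inf_max f g).
Proof.
have [t10 t12] := (t1_ge0, t1_lt_t2); have ph := phase01.
have gf : f t2 = g (t2 + phase) by rewrite phase_lag//; lra.
rewrite /resonance_interval in_itv/= (@inf_image_min _ f t2) //; last lra.
rewrite (@inf_image_min _ g (t2 + phase)) -?gf ?maxxx//; first lra.
by move=> t t0; rewrite lagged_shift// f_ge_min//; lra.
Qed.

Lemma resonance_objective_increment : f t2 < inf_max f g ->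
  exists x0 h1, [/\ t1 < x0 < t2, f x0 = inf_max f g, 0 < h1 &
    forall h x, 0 < h < h1 -> x0 < x < t2 ->
      t1 < x - h /\ resonance_objective f g h (f x) = f x - f (x - h)].
Proof.
have [t10 t12] := (t1_ge0, t1_lt_t2); have ph := phase01.
move=> M2.
have M1 : inf_max f g < f t1 by apply: lt_le_trans f_0 _; exact: f_le_max.
have [x0 x0I fx0] := decreasing_branch_onto (inf_max f g) ltac:(by rewrite M2 M1).
have Mg : inf_max f g < f (1 - phase) by rewrite -[1 - _]add0r -lagged_shift.
have [n nP] := hitting_time_shift 0 (inf_max f g) (lexx _) f_0.
have [m mP] := hitting_time_shift (1 - phase) (inf_max f g) ltac:(lra) Mg.
have [n0 _] := nP x0 x0I ltac:(by rewrite fx0).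
have [m0 _] := mP x0 x0I ltac:(by rewrite fx0).
(* The three bounds on [h] keep [x - h] beyond [t1] and both hitting times beyond [h]. *)
exists x0, (Num.min (x0 - t1) (Num.min (x0 + n%:~R) (x0 + m%:~R - (1 - phase)))).
split=> //; first by rewrite !lt_min; lra.
move=> h x /andP[h0]; rewrite !lt_min => hI xI; split; first by lra.
have xM : f x <= inf_max f g by rewrite -fx0 ltW// decreasing_branch//; lra.
have xI' : t1 < x < t2 by lra.
rewrite /resonance_objective.
have [_ ->] := nP x xI' xM; last by move=> t _; rewrite addr0.
have [_ ->] := mP x xI' xM; last by move=> t; exact: lagged_shift.
have -> : f (x + n%:~R - 0 - h) = f (x - h).
  have -> : x + n%:~R - 0 - h = x - h + n%:~R by lra.
  by apply: periodic_int; lra.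
have -> : g (x + m%:~R - (1 - phase) - h) = f (x - h).
  rewrite lagged_shift; last lra.
  have -> : x + m%:~R - (1 - phase) - h + (1 - phase) = x - h + m%:~R by lra.
  by apply: periodic_int; lra.
by rewrite maxxx.
Qed.

(** * Location of the minimizers and their limit *)

(** Before [s] a step to the right lowers the increment; beyond [s + h] a step to the left does. The
    maximum with [x0] covers an inflection point whose level is not in the interval. *)
Lemma increment_minimizer_bounds (x0 h x : R) : 0 < h -> t1 < x0 - h ->
  x0 < x < t2 ->
  (forall z, x0 < z < t2 -> f x - f (x - h) <= f z - f (z - h)) ->
  Num.max x0 s <= x <= Num.max x0 s + h.
Proof.
move=> h0 x0h xI xmin; have [/andP[t1s st2] ccv cvx] := s_inflection.
have xs : s <= x.
  rewrite leNgt; apply/negP => xs.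
  have := xmin ((x + s) / 2%:R) ltac:(lra).
  have := @strictly_concave_increment _ f t1 s x ((x + s) / 2%:R) h ccv h0
    ltac:(lra) ltac:(lra) ltac:(lra).
  lra.
have : x <= Num.max x0 s + h.
  rewrite leNgt; apply/negP; rewrite -ltrBrDr gt_max => /andP[xx0 xxs].
  (* The midpoint of [y] and [x] is a better competitor: it precedes [x], and its window of length
     [h] lies in the convex part. *)
  set y := Num.max (x0 + h) (s + h).
  have yx : y < x by rewrite gt_max; lra.
  have [y0 ys] : x0 + h <= y /\ s + h <= y by rewrite !le_max !lexx orbT.
  have := xmin ((y + x) / 2%:R) ltac:(lra).
  have := @strictly_convex_increment _ f s t2 ((y + x) / 2%:R) x h cvx h0
    ltac:(lra) ltac:(lra) ltac:(lra).
  lra.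
by rewrite ge_max => ->; rewrite xs; lra.
Qed.

Lemma cvg_squeezed_argument (x_ : R -> R) (y : R) : 0 < y ->
  (\forall h \near 0^'+, y <= x_ h <= y + h) ->
  f (x_ h) @[h --> 0^'+] --> f y.
Proof.
move=> y0 xy; apply: (cvg_comp x_ f); last exact: f_continuous.
apply: (squeeze_cvgr xy); first exact: cvg_cst.
rewrite -[X in _ --> X]addr0; apply: cvgD; first exact: cvg_cst.
exact: cvg_at_right_filter.
Qed.

(** Minimizing levels are pulled back to the decreasing branch, where their preimages are squeezed
    to [Num.max x0 s]. *)
Lemma resonance_point_unique muR :
  stochastic_resonance_point f g muR -> muR = f s.
Proof.
have [t10 t12] := (t1_ge0, t1_lt_t2).
have [/andP[t1s st2] _ _] := s_inflection.
case=> + [mu_ [mu_min mu_cvg]]; rewrite mem_resonance_interval => /andP[muR2 muRM].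
have [x0 [h1 [x0I fx0 h10 objE]]] := resonance_objective_increment ltac:(lra).
have f0 := f_le_max 0 (lexx _).
have preimage h : exists x, f t2 < mu_ h < inf_max f g -> x0 < x < t2 /\ f x = mu_ h.
  have [hI|] := boolP (f t2 < mu_ h < inf_max f g); last by exists 0.
  have [|x xI fx] := decreasing_branch_onto (mu_ h); first by have := f_0; lra.
  exists x => _; split=> //; apply/andP; split; last by lra.
  rewrite ltNge; apply/negP => xx0.
  have [xE|xE] := eqVneq x x0; first by rewrite -xE fx in fx0; lra.
  by have := decreasing_branch x x0 ltac:(lra) ltac:(lra) ltac:(lra); lra.
have [x_ x_P] := boolp.choice preimage.
pose y := Num.max x0 s.
have y0 : 0 < y by rewrite lt_max; apply/orP; left; lra.
have near_xy : \forall h \near 0^'+, f (x_ h) = mu_ h /\ y <= x_ h <= y + h.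
  near=> h.
  have [muI hmin] : mu_ h \in resonance_interval f g /\
      forall mu, mu \in resonance_interval f g ->
        resonance_objective f g h (mu_ h) <= resonance_objective f g h mu.
    by near: h.
  have h0 : 0 < h by near: h; exact: nbhs_right_gt.
  have hh1 : h < h1 by near: h; exact: nbhs_right_lt.
  have hx0 : h < x0 - t1 by near: h; apply: nbhs_right_lt; lra.
  rewrite mem_resonance_interval in muI.
  have [xI fx] := x_P h muI; split=> //.
  apply: increment_minimizer_bounds; rewrite ?h0//; first by lra.
  move=> z zI; have := hmin (f z).
  rewrite -fx mem_resonance_interval -fx0 !(objE h _ _ _).2 ?h0 ?hh1//; apply.
  by rewrite !decreasing_branch//; lra.
have cvg1 : f (x_ h) @[h --> 0^'+] --> f y.
  by apply: cvg_squeezed_argument => //; apply: filterS near_xy => h [].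
have cvg2 : f (x_ h) @[h --> 0^'+] --> muR.
  apply: cvg_trans mu_cvg; apply: near_eq_cvg.
  by apply: filterS near_xy => h [].
have muRE : muR = f y := cvg_unique (@norm_hausdorff _ _) cvg2 cvg1.
(* If [s < x0], the limit would be the upper end of the open interval. *)
have [x0s|sx0] := leP x0 s; first by rewrite muRE /y max_r.
by move: muRM; rewrite muRE /y max_l ?fx0 ?ltxx// ltW.
Unshelve. all: by end_near. Qed.

(** Membership of [f s] in the interval means [x0 < s < t2]; minimizers then exist by compactness
    and are squeezed to [s]. *)
Lemma resonance_point_inflection :
  f s \in resonance_interval f g -> stochastic_resonance_point f g (f s).
Proof.
have [t10 t12] := (t1_ge0, t1_lt_t2).
have [/andP[t1s st2] ccv cvx] := s_inflection.
move=> fsI; split=> //; move: fsI; rewrite mem_resonance_interval => /andP[fs2 fsM].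
have [x0 [h1 [x0I fx0 h10 objE]]] := resonance_objective_increment ltac:(lra).
have f0 := f_le_max 0 (lexx _).
have x0s : x0 < s.
  rewrite ltNge; apply/negP => sx0.
  have [E|sx] := eqVneq s x0; first by rewrite E fx0 ltxx in fsM.
  by have := decreasing_branch s x0 ltac:(lra) ltac:(lra) ltac:(lra); lra.
pose h2 := Num.min h1 (Num.min (x0 - t1) ((t2 - s) / 2%:R)).
have minimizer h : exists x, 0 < h < h2 ->
    s <= x <= s + h /\ forall z, x0 < z < t2 -> f x - f (x - h) <= f z - f (z - h).
  have [|] := boolP (0 < h < h2); last by exists 0.
  rewrite /h2 !lt_min => hI.
  (* Left of [c < s] increments decrease and right of [c' > s + h] they increase, so a minimizer on
     [[c, c']] is one on all of []x0, t2[]. *)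
  pose c := (x0 + s) / 2%:R; pose c' := (s + h + t2) / 2%:R.
  have [||x xI xmin] := @EVT_min R (fun x => f x - f (x - h)) c c'.
  - by rewrite /c /c'; lra.
  - apply: continuous_in_subspaceT => x; rewrite inE/= in_itv/= /c /c' => xI.
    apply: cvgB; first by apply: f_continuous; lra.
    apply: (@continuous_comp _ _ _ (fun x => x - h) f).
      by apply: cvgB; [exact: cvg_id | exact: cvg_cst].
    by apply: f_continuous; lra.
  have xmin' z : x0 < z < t2 -> f x - f (x - h) <= f z - f (z - h).
    move=> zI.
    have [zc|cz] := ltP z c.
      apply: le_trans (xmin c _) _; first by rewrite in_itv/= /c /c'; lra.
      by apply/ltW/(strictly_concave_increment _ _ _ _ _ _ _ ccv); rewrite /c in zc *; lra.
    have [zc'|cz'] := leP z c'; first by apply: xmin; rewrite in_itv/= cz zc'.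
    apply: le_trans (xmin c' _) _; first by rewrite in_itv/= /c /c'; lra.
    by apply/ltW/(strictly_convex_increment _ _ _ _ _ _ _ cvx); rewrite /c' in cz' *; lra.
  exists x => _; split=> //.
  rewrite in_itv/= /c /c' in xI.
  have := increment_minimizer_bounds x0 h x ltac:(lra) ltac:(lra) ltac:(lra) xmin'.
  by rewrite max_r// ltW.
have [x_ x_P] := boolp.choice minimizer.
have h20 : 0 < h2 by rewrite !lt_min h10; lra.
have x_near : \forall h \near 0^'+, 0 < h < h2.
  near=> h; apply/andP; split; near: h; [exact: nbhs_right_gt | exact: nbhs_right_lt].
exists (fun h => f (x_ h)); split; last first.
  apply: cvg_squeezed_argument; first by lra.
  by apply: filterS x_near => h /x_P[].
apply: filterS x_near => h hI; have [xI xmin] := x_P h hI.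
move: hI; rewrite /h2 !lt_min => hI.
have xI' : x0 < x_ h < t2 by lra.
split; first by rewrite mem_resonance_interval -fx0 !decreasing_branch//; lra.
move=> mu; rewrite mem_resonance_interval => muI.
have [|z zI fz] := decreasing_branch_onto mu; first by have := f_0; lra.
have x0z : x0 < z.
  rewrite ltNge; apply/negP => xx0.
  have [xE|xE] := eqVneq z x0; first by rewrite -xE fz in fx0; lra.
  by have := decreasing_branch z x0 ltac:(lra) ltac:(lra) ltac:(lra); lra.
rewrite -fz !(objE h _ _ _).2 ?xmin//; lra.
Unshelve. all: by end_near. Qed.

End PeriodicWell.

(** The value of any resonance point is identified first; existence is then shown when the
    inflection level lies in the open interval, as a resonance point must. *)
Theorem theorem3p4 (R : realType) (d : nat) (hd : (0 < d)%N)
  (b : R -> 'rV[R]_d -> 'rV[R]_d)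
  (b_periodic : one_periodic_drift b)
  (b_lipschitz : locally_lipschitz b)
  (b_dissipative : dissipative b)
  (xm xp : 'rV[R]_d) (xm_neq_xp : xm != xp)
  (xm_stable : forall s : R, 0 <= s -> stable_equilibrium b s xm)
  (xp_stable : forall s : R, 0 <= s -> stable_equilibrium b s xp)
  (Am Ap : set 'rV[R]_d)
  (Am_def : forall s : R, 0 <= s -> domain_of_attraction b s xm = Am)
  (Ap_def : forall s : R, 0 <= s -> domain_of_attraction b s xp = Ap)
  (A_dense : closure (Am `|` Ap) = setT)
  (chi : set 'rV[R]_d) (chi_m : boundary Am = chi) (chi_p : boundary Ap = chi)
  (em_finite : forall s : R, 0 <= s -> (exit_energy b chi xm s < +oo)%E)
  (ep_finite : forall s : R, 0 <= s -> (exit_energy b chi xp s < +oo)%E)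
  (em_monotone : monotone_between_extrema (energy b chi xm))
  (ep_monotone : monotone_between_extrema (energy b chi xp))
  (em_0 : inf_max (energy b chi xm) (energy b chi xp) < energy b chi xm 0)
  (ep_0 : inf_max (energy b chi xm) (energy b chi xp) < energy b chi xp 0)
  (phase : R) (phase01 : 0 < phase < 1)
  (phase_lag : forall t : R, 0 <= t -> energy b chi xm t = energy b chi xp (t + phase))
  (em_C2 : twice_continuously_differentiable (energy b chi xm))
  (t1 t2 : R)
  (em_max : global_max_at (energy b chi xm) t1)
  (em_min : global_min_at (energy b chi xm) t2)
  (t1_lt_t2 : t1 < t2)
  (s : R) (s_inflection : unique (inflection_between (energy b chi xm) t1 t2) s) :
  (forall muR : R,
     stochastic_resonance_point (energy b chi xm) (energy b chi xp) muR ->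
     muR = energy b chi xm s) /\
  (energy b chi xm s \in resonance_interval (energy b chi xm) (energy b chi xp) ->
   stochastic_resonance_point (energy b chi xm) (energy b chi xp)
     (energy b chi xm s)).
Proof.
have [infl _] := s_inflection.
have em_continuous t : 0 < t -> {for t, continuous (energy b chi xm)}.
  move=> t0; have [em_derivable _ _] := em_C2 t t0.
  exact/differentiable_continuous/derivable1_diffP.
have per x := @energy_periodic _ _ _ chi x b_periodic.
split=> [muR|].
  exact: (resonance_point_unique _ t1 t2 _ (per xm) em_monotone em_max em_min
    t1_lt_t2 infl em_continuous _ phase (per xp)).
exact: (resonance_point_inflection _ t1 t2 _ (per xm) em_monotone em_max em_min
  t1_lt_t2 infl em_continuous _ phase (per xp)).
Qed.
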